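(* Let $W=W_{A_{n-1}}$ ($n\ge2$), $W_{B_n}$ ($n\ge2$), or $W_{D_n}$ ($n\ge4$), let $\mathfrak{H}^-_W$ be the degenerate spin affine Hecke algebra and $\mathfrak{I}_i\in\mathfrak{H}^-_W$ the intertwiners. The following identities hold in $\mathfrak{H}^-_W$: (1) $\mathfrak{I}_i^2=u^2(b_{i+1}^2+b_i^2)-(b_{i+1}^2-b_i^2)^2$ for $1\le i\le n-1$ and every type of $W$; (2) $\mathfrak{I}_n^2=u^2(b_n^2+b_{n-1}^2)-(b_n^2-b_{n-1}^2)^2$ for type $D_n$; (3) $\mathfrak{I}_n^2=4b_n^4-v^2b_n^2$ for type $B_n$.
   Context: All algebras are unital associative over $\mathbb{C}$; $u,v\in\mathbb{C}$ are parameters. $\mathfrak{H}^-_W$ is generated by $b_1,\dots,b_n$ and $t_1,\dots,t_{n-1}$ (type $A_{n-1}$), or $b_1,\dots,b_n$ and $t_1,\dots,t_n$ (types $B_n$, $D_n$), subject to: $t_i^2=1$; $t_it_{i+1}t_i=t_{i+1}t_it_{i+1}$ ($1\le i\le n-2$); $t_it_j=-t_jt_i$ ($|i-j|>1$, $i,j\le n-1$); in type $D_n$: $t_it_n=-t_nt_i$ ($i\neq n-2,n$), $t_{n-2}t_nt_{n-2}=t_nt_{n-2}t_n$; in type $B_n$: $t_it_n=-t_nt_i$ ($i\le n-2$), $(t_{n-1}t_n)^4=-1$; $b_ib_j=-b_jb_i$ ($i\neq j$); for $1\le i\le n-1$: $t_ib_i+b_{i+1}t_i=u$, $t_ib_j=-b_jt_i$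 ($j\neq i,i+1$); in type $D_n$: $t_nb_n+b_{n-1}t_n=u$, $t_nb_i=-b_it_n$ ($i\ne n-1,n$); in type $B_n$: $t_nb_n+b_nt_n=v$, $t_nb_i=-b_it_n$ ($i\neq n$). Intertwiners: $\mathfrak{I}_i=(b_{i+1}^2-b_i^2)t_i-u(b_{i+1}-b_i)$ ($1\le i\le n-1$); in type $D_n$, $\mathfrak{I}_n=(b_n^2-b_{n-1}^2)t_n-u(b_n-b_{n-1})$; in type $B_n$, $\mathfrak{I}_n=2b_n^2t_n-vb_n$. *)

(* Defs.v *)
From HB Require Import structures.
From mathcomp Require Import all_boot all_order all_algebra.
From mathcomp Require Import boolp reals complex.
From mathcomp Require Import finmap monalg.

Set Implicit Arguments.
Unset Strict Implicit.
Unset Printing Implicit Defensive.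

Import GRing.Theory.
Local Open Scope ring_scope.
Local Open Scope quotient_scope.

Section FreeAlgebra.
Variables (K : comNzRingType) (G : choiceType).

Definition free_algebra : Type := {malg K[{fmonom G}]}.

HB.instance Definition _ := GRing.Lmodule.on free_algebra.

(* The products below are locked only because conversion tests between
   products of {malg _[_]} are extremely slow. *)
Fact free_mul_key : unit. Proof. by []. Qed.
Definition free_mul : free_algebra -> free_algebra -> free_algebra :=
  locked_with free_mul_key ( *%R : {malg K[{fmonom G}]} -> _ -> _).

Fact free_mulE : free_mul = ( *%R : {malg K[{fmonom G}]} -> _ -> _).
Proof. by rewrite /free_mul unlock. Qed.

Local Notation one := (1 : {malg K[{fmonom G}]}).

Fact free_mulA : associative free_mul.
Proof. by rewrite free_mulE; exact: mulrA. Qed.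

Fact free_mul1l : left_id (one : free_algebra) free_mul.
Proof. by rewrite free_mulE; exact: mul1r. Qed.

Fact free_mul1r : right_id (one : free_algebra) free_mul.
Proof. by rewrite free_mulE; exact: mulr1. Qed.

Fact free_mulDl : left_distributive free_mul +%R.
Proof. by rewrite free_mulE; exact: mulrDl. Qed.

Fact free_mulDr : right_distributive free_mul +%R.
Proof. by rewrite free_mulE; exact: mulrDr. Qed.

Fact free_oner_neq0 : (one : free_algebra) != 0.
Proof. exact: (oner_neq0 {malg K[{fmonom G}]}). Qed.

HB.instance Definition _ := GRing.Zmodule_isNzRing.Build free_algebra
  free_mulA free_mul1l free_mul1r free_mulDl free_mulDr free_oner_neq0.

Fact free_scalerAl (k : K) (x y : free_algebra) :
  k *: free_mul x y = free_mul (k *: x) y.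
Proof.
rewrite free_mulE.
exact: (@scalerAl K {malg K[{fmonom G}]}).
Qed.

HB.instance Definition _ :=
  GRing.Lmodule_isLalgebra.Build K free_algebra free_scalerAl.

Fact free_scalerAr (k : K) (x y : free_algebra) :
  k *: free_mul x y = free_mul x (k *: y).
Proof.
rewrite free_mulE.
apply/malgP => m; rewrite mcoeffZ.
rewrite (mcoeffMlw m (fsubset_refl _) (fsubset_refl _)).
rewrite (mcoeffMlw m (fsubset_refl _) (msuppZ_le _ _)).
rewrite mulr_sumr; apply: eq_bigr => k1 _.
rewrite mulr_sumr; apply: eq_bigr => k2 _.
by rewrite mcoeffZ mulrnAr; congr (_ *+ _); rewrite mulrCA.
Qed.

HB.instance Definition _ :=
  GRing.Lalgebra_isAlgebra.Build K free_algebra free_scalerAr.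

Definition free_gen (g : G) : free_algebra := << fmu g >>.

End FreeAlgebra.

Section PresentedAlgebra.
Variables (K : comNzRingType) (A : algType K) (rels : A -> A -> Prop).

Record two_sided_ideal (J : A -> Prop) : Prop := TwoSidedIdeal {
  ideal0 : J 0;
  idealB : forall x y, J x -> J y -> J (x - y);
  idealMl : forall a x, J x -> J (a * x);
  idealMr : forall a x, J x -> J (x * a)
}.

Definition rel_ideal : {pred A} := fun x =>
  `[< forall J, two_sided_ideal J ->
        (forall l r, rels l r -> J (l - r)) -> J x >].

Fact rel_idealP x : reflect
  (forall J, two_sided_ideal J -> (forall l r, rels l r -> J (l - r)) -> J x)
  (x \in rel_ideal).
Proof. exact: asboolP. Qed.

Fact rel_ideal_zmod_closed : zmod_closed rel_ideal.
Proof.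
split=> [|x y /rel_idealP Jx /rel_idealP Jy]; apply/rel_idealP => J IJ relJ.
  exact: ideal0 IJ.
by apply: (idealB IJ); [apply: Jx | apply: Jy].
Qed.

HB.instance Definition _ := GRing.isZmodClosed.Build A rel_ideal
  rel_ideal_zmod_closed.

Fact rel_idealMl a x : x \in rel_ideal -> a * x \in rel_ideal.
Proof.
move=> /rel_idealP Jx; apply/rel_idealP => J IJ relJ.
by apply: (idealMl IJ); apply: Jx.
Qed.

Fact rel_idealMr a x : x \in rel_ideal -> x * a \in rel_ideal.
Proof.
move=> /rel_idealP Jx; apply/rel_idealP => J IJ relJ.
by apply: (idealMr IJ); apply: Jx.
Qed.

(* The library equips a quotient with a product only when the base ring is
   commutative, hence the ring and module structures below.  [algType] asks
   for 1 != 0, which is not needed here: the remaining algebra axioms are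
   [presented_scalerAl] and [presented_scalerAr]. *)
Definition presented : Type := Quotient.quot rel_ideal.

HB.instance Definition _ := GRing.Zmodule.on presented.
HB.instance Definition _ := Quotient.on presented.

Definition proj (x : A) : presented := \pi_(Quotient.quot rel_ideal) x.

Fact proj_eqP x y : proj x = proj y <-> x - y \in rel_ideal.
Proof. by rewrite Quotient.idealrBE; split=> /eqP. Qed.

Fact proj_is_zmod_morphism : zmod_morphism proj.
Proof. exact: (raddfB (\pi_(Quotient.quot rel_ideal))). Qed.

HB.instance Definition _ :=
  GRing.isZmodMorphism.Build A presented proj proj_is_zmod_morphism.

Definition presented_repr (q : presented) : A :=
  repr (q : Quotient.quot rel_ideal).

Fact reprQK q : proj (presented_repr q) = q.
Proof. exact: reprK. Qed.

Definition presented_one : presented := proj 1.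

Fact presented_key : unit. Proof. by []. Qed.
Definition presented_mul : presented -> presented -> presented :=
  locked_with presented_key
    (fun p q => proj (presented_repr p * presented_repr q)).
Definition presented_scale : K -> presented -> presented :=
  locked_with presented_key (fun k q => proj (k *: presented_repr q)).

Let projM x y : presented_mul (proj x) (proj y) = proj (x * y).
Proof.
rewrite /presented_mul unlock; apply/proj_eqP.
have Ix : presented_repr (proj x) - x \in rel_ideal
  by apply/proj_eqP/reprQK.
have Iy : presented_repr (proj y) - y \in rel_ideal
  by apply/proj_eqP/reprQK.
rewrite -[_ * _](addrNK (x * presented_repr (proj y))) -mulrBl -addrA -mulrBr.
by apply: rpredD; [exact: rel_idealMr | exact: rel_idealMl].
Qed.

Let projZ k x : presented_scale k (proj x) = proj (k *: x).
Proof.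
rewrite /presented_scale unlock; apply/proj_eqP; rewrite -scalerBr -mulr_algl.
by apply: rel_idealMl; apply/proj_eqP/reprQK.
Qed.

Fact presented_mulA : associative presented_mul.
Proof.
move=> p q r; rewrite -[p]reprQK -[q]reprQK -[r]reprQK.
by rewrite !projM mulrA.
Qed.

Fact presented_mul1l : left_id presented_one presented_mul.
Proof. by move=> p; rewrite -[p]reprQK projM mul1r. Qed.

Fact presented_mul1r : right_id presented_one presented_mul.
Proof. by move=> p; rewrite -[p]reprQK projM mulr1. Qed.

Fact presented_mulDl : left_distributive presented_mul +%R.
Proof.
move=> p q r; rewrite -[p]reprQK -[q]reprQK -[r]reprQK.
by rewrite -raddfD !projM -raddfD mulrDl.
Qed.

Fact presented_mulDr : right_distributive presented_mul +%R.
Proof.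
move=> p q r; rewrite -[p]reprQK -[q]reprQK -[r]reprQK.
by rewrite -raddfD !projM -raddfD mulrDr.
Qed.

HB.instance Definition _ := GRing.Zmodule_isPzRing.Build presented
  presented_mulA presented_mul1l presented_mul1r
  presented_mulDl presented_mulDr.

Fact presented_scalerA a b q :
  presented_scale a (presented_scale b q) = presented_scale (a * b) q.
Proof. by rewrite -[q]reprQK !projZ scalerA. Qed.

Fact presented_scale1r : left_id 1 presented_scale.
Proof. by move=> q; rewrite -[q]reprQK projZ scale1r. Qed.

Fact presented_scalerDr : right_distributive presented_scale +%R.
Proof.
move=> a p q; rewrite -[p]reprQK -[q]reprQK.
by rewrite -raddfD !projZ -raddfD scalerDr.
Qed.

Fact presented_scalerDl q : {morph presented_scale^~ q : a b / a + b}.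
Proof. by move=> a b; rewrite -[q]reprQK !projZ -raddfD scalerDl. Qed.

HB.instance Definition _ := GRing.Zmodule_isLmodule.Build K presented
  presented_scalerA presented_scale1r presented_scalerDr presented_scalerDl.

Fact proj_is_monoid_morphism : monoid_morphism proj.
Proof. by split=> // x y; rewrite -projM. Qed.

HB.instance Definition _ :=
  GRing.isMonoidMorphism.Build A presented proj proj_is_monoid_morphism.

Fact proj_is_scalable : scalable proj.
Proof. by move=> k x; rewrite -projZ. Qed.

HB.instance Definition _ :=
  GRing.isScalable.Build K A presented *:%R proj proj_is_scalable.

Lemma presented_scalerAl k (p q : presented) : k *: (p * q) = (k *: p) * q.
Proof.
rewrite -[p]reprQK -[q]reprQK -rmorphM -!linearZ.
by rewrite -rmorphM scalerAl.
Qed.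

Lemma presented_scalerAr k (p q : presented) : k *: (p * q) = p * (k *: q).
Proof.
rewrite -[p]reprQK -[q]reprQK -rmorphM -!linearZ.
by rewrite -rmorphM scalerAr.
Qed.

Lemma proj_rel l r : rels l r -> proj l = proj r.
Proof. by move=> lr; apply/proj_eqP/rel_idealP => J _; apply. Qed.

End PresentedAlgebra.

(* [TypeA] with parameter n stands for W_{A_{n-1}}, so that n is the number of
   generators b_i in all three types. *)
Inductive weyl_type := TypeA | TypeB | TypeD.

Definition weyl_rank (W : weyl_type) (n : nat) : nat :=
  if W is TypeA then n.-1 else n.

Definition weyl_admissible (W : weyl_type) (n : nat) : bool :=
  if W is TypeD then (4 <= n)%N else (2 <= n)%N.

(* Indices are 1-based. *)
Definition hecke_index (W : weyl_type) (n : nat) : choiceType :=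
  ({i : nat | (1 <= i <= n)%N} + {i : nat | (1 <= i <= weyl_rank W n)%N})%type.

Section SpinAffineHecke.
Variables (R : realType) (W : weyl_type) (n : nat) (u v : R[i]).

Local Notation F := (free_algebra R[i] (hecke_index W n)).

(* Outside 1 <= i <= n, resp. 1 <= i <= weyl_rank W n, these are 0; the
   relations below only involve indices in range. *)
Definition bF (i : nat) : F :=
  if insub i is Some j then free_gen R[i] (inl j : hecke_index W n) else 0.

Definition tF (i : nat) : F :=
  if insub i is Some j then free_gen R[i] (inr j : hecke_index W n) else 0.

Local Notation b := bF.
Local Notation t := tF.

Inductive hecke_rel : F -> F -> Prop :=
| rel_tt i : (1 <= i <= weyl_rank W n)%N ->
    hecke_rel (t i ^+ 2) 1
| rel_braid i : (1 <= i <= n.-2)%N ->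
    hecke_rel (t i * t i.+1 * t i) (t i.+1 * t i * t i.+1)
| rel_tanti i j : (1 <= i <= n.-1)%N -> (1 <= j <= n.-1)%N ->
    (i.+1 < j)%N || (j.+1 < i)%N ->
    hecke_rel (t i * t j) (- (t j * t i))
| relD_tanti i : W = TypeD -> (1 <= i <= n)%N -> i != n.-2 -> i != n ->
    hecke_rel (t i * t n) (- (t n * t i))
| relD_braid : W = TypeD ->
    hecke_rel (t n.-2 * t n * t n.-2) (t n * t n.-2 * t n)
| relB_tanti i : W = TypeB -> (1 <= i <= n.-2)%N ->
    hecke_rel (t i * t n) (- (t n * t i))
| relB_braid : W = TypeB ->
    hecke_rel ((t n.-1 * t n) ^+ 4) (-1)
| rel_banti i j : (1 <= i <= n)%N -> (1 <= j <= n)%N -> i != j ->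
    hecke_rel (b i * b j) (- (b j * b i))
| rel_tb i : (1 <= i <= n.-1)%N ->
    hecke_rel (t i * b i + b i.+1 * t i) u%:A
| rel_tbanti i j : (1 <= i <= n.-1)%N -> (1 <= j <= n)%N ->
    j != i -> j != i.+1 ->
    hecke_rel (t i * b j) (- (b j * t i))
| relD_tb : W = TypeD ->
    hecke_rel (t n * b n + b n.-1 * t n) u%:A
| relD_tbanti i : W = TypeD -> (1 <= i <= n)%N -> i != n.-1 -> i != n ->
    hecke_rel (t n * b i) (- (b i * t n))
| relB_tb : W = TypeB ->
    hecke_rel (t n * b n + b n * t n) v%:A
| relB_tbanti i : W = TypeB -> (1 <= i <= n)%N -> i != n ->
    hecke_rel (t n * b i) (- (b i * t n)).

Definition spin_hecke : Type := presented hecke_rel.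

HB.instance Definition _ := GRing.PzRing.on spin_hecke.
HB.instance Definition _ := GRing.Lmodule.on spin_hecke.

Definition hecke_b (i : nat) : spin_hecke := proj hecke_rel (bF i).
Definition hecke_t (i : nat) : spin_hecke := proj hecke_rel (tF i).

(* Meaningful for 1 <= i <= weyl_rank W n. *)
Definition intertwiner (i : nat) : spin_hecke :=
  if (i < n)%N then
    (hecke_b i.+1 ^+ 2 - hecke_b i ^+ 2) * hecke_t i
      - u *: (hecke_b i.+1 - hecke_b i)
  else match W with
  | TypeA => 0
  | TypeB => (hecke_b n ^+ 2 * hecke_t n) *+ 2 - v *: hecke_b n
  | TypeD => (hecke_b n ^+ 2 - hecke_b n.-1 ^+ 2) * hecke_t n
               - u *: (hecke_b n - hecke_b n.-1)
  end.

End SpinAffineHecke.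

(* Main.v *)
(* From [t^2 = 1] and [t x + y t = u] one also gets [t y + x t = u], so [t] acts
   on [D = y^2 - x^2] and [E = y - x] by [t D = 2 u E - D t] and [t E = E t].  As
   [D] and [E] commute, the cross terms of [(D t - u E)^2] cancel and leave
   [u^2 E^2 - D^2], where [E^2 = y^2 + x^2] since [x] and [y] anticommute.  In
   type D the last relation exchanges the roles of [x] and [y], which only
   changes the sign of the intertwiner.  In type B one has [x = y], [t] commutes
   with [x^2], and the same computation applies. *)

Require Import Defs.
From mathcomp Require Import all_boot all_order all_algebra.
From mathcomp Require Import reals complex.

Import GRing.Theory.
Local Open Scope ring_scope.

(** The scalar [u] is replaced by a central element [c], so that everything is a computation in a
    bare ring. *)
Lemma intertwiner_sqr (A : pzRingType) (c t x y : A) :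
    (forall a, c * a = a * c) -> t ^+ 2 = 1 -> t * x + y * t = c ->
    x * y = - (y * x) ->
  ((y ^+ 2 - x ^+ 2) * t - c * (y - x)) ^+ 2
    = c ^+ 2 * (y ^+ 2 + x ^+ 2) - (y ^+ 2 - x ^+ 2) ^+ 2.
Proof.
move=> cC tt txc xy; rewrite expr2 in tt.
have tx : t * x = c - y * t by rewrite -txc addrK.
(* Conjugating [txc] by the involution [t] turns it into [x * t + t * y = c]. *)
have ty : t * y = c - x * t.
  have : t * c * t = c by rewrite -cC -mulrA tt mulr1.
  rewrite -{1}txc mulrDr mulrDl !mulrA tt mul1r -!mulrA tt mulr1 => <-.
  by rewrite addrAC subrr add0r.
set D := y ^+ 2 - x ^+ 2; set E := y - x.
have tE : t * E = E * t.
  by rewrite /E mulrBr tx ty mulrBl opprB addrC addrA subrK addrC.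
have EE : E ^+ 2 = y ^+ 2 + x ^+ 2.
  by rewrite /E expr2 mulrBr !mulrBl xy !expr2 opprB opprK addrACA addrA addrK.
(* Moving [t] past a square exchanges [x] and [y]: the corrections are [c * E] for [y ^+ 2] and
   [- (c * E)] for [x ^+ 2], whence the factor 2. *)
have tD : t * D = (c * E) *+ 2 - D * t.
  have -> : t * D = c * y - x * c + x * x * t - (c * x - y * c + y * y * t).
    rewrite /D mulrBr !expr2 !mulrA tx ty !mulrBl -!mulrA tx ty !mulrBr !mulrA.
    by rewrite !opprD !opprK !addrA.
  rewrite -!cC -!mulrBr -/E -[x - y]opprB -/E mulrN /D mulrBl !expr2.
  by rewrite !opprD !opprK addrACA -mulr2n [_ * t - _]addrC.
have DE : E * D = D * E.
  have x2y : x * x * y = y * (x * x).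
    by rewrite -mulrA xy mulrN mulrA xy mulNr opprK mulrA.
  have y2x : y * y * x = x * (y * y).
    by rewrite [RHS]mulrA xy mulNr -[in RHS]mulrA xy mulrN opprK mulrA.
  by rewrite /D /E !expr2 !mulrBl !mulrBr x2y y2x !mulrA !opprD !opprK addrACA.
rewrite expr2 mulrBl 2![_ * (_ - _ * _)]mulrBr.
have -> : D * t * (D * t) = c * (D * E * t) *+ 2 - D ^+ 2.
  rewrite mulrA -(mulrA D t D) tD mulrBr mulrBl -!mulrA tt mulr1 mulrA -expr2.
  by rewrite mulrnAr mulrnAl !mulrA -(cC D).
have -> : D * t * (c * E) = c * (D * E * t).
  by rewrite mulrA -cC -!mulrA tE.
have -> : c * E * (D * t) = c * (D * E * t) by rewrite -DE !mulrA.
have -> : c * E * (c * E) = c ^+ 2 * (y ^+ 2 + x ^+ 2).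
  by rewrite -EE !expr2 !mulrA -(mulrA c E c) -(cC E) !mulrA.
by rewrite (addrAC (_ *+ 2)) mulr2n addrK opprB addrC addrA addrAC addrK addrC.
Qed.

(** Fits [relD_tb], with [b n] as [x] and [b n.-1] as [y]. *)
Lemma intertwiner_swap_sqr (A : pzRingType) (c t x y : A) :
    (forall a, c * a = a * c) -> t ^+ 2 = 1 -> t * x + y * t = c ->
    x * y = - (y * x) ->
  ((x ^+ 2 - y ^+ 2) * t - c * (x - y)) ^+ 2
    = c ^+ 2 * (x ^+ 2 + y ^+ 2) - (x ^+ 2 - y ^+ 2) ^+ 2.
Proof.
move=> cC tt txc xy; rewrite -(opprB y x) -(opprB (y ^+ 2)) mulNr mulrN -opprD.
by rewrite !sqrrN [x ^+ 2 + _]addrC intertwiner_sqr.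
Qed.

(** Putting [y = x] in [intertwiner_sqr] would make its element vanish, so type B needs its own
    expansion. *)
Lemma intertwinerB_sqr (A : pzRingType) (c t x : A) :
    (forall a, c * a = a * c) -> t ^+ 2 = 1 -> t * x + x * t = c ->
  ((x ^+ 2 * t) *+ 2 - c * x) ^+ 2 = x ^+ 4 *+ 4 - c ^+ 2 * x ^+ 2.
Proof.
move=> cC tt txc.
have tx : t * x = c - x * t by rewrite -txc addrK.
have tx2 : t * x ^+ 2 = x ^+ 2 * t.
  by rewrite expr2 mulrA tx mulrBl -(mulrA x t) tx mulrBr cC subKr mulrA.
rewrite expr2 mulrBl 2![_ * (_ - _ * _)]mulrBr.
have -> : (x ^+ 2 * t) *+ 2 * ((x ^+ 2 * t) *+ 2) = x ^+ 4 *+ 4.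
  rewrite mulrnAl mulrnAr -mulrnA mulrA -(mulrA _ t) tx2 mulrA -exprD.
  by rewrite -mulrA -expr2 tt mulr1.
(* By [tx], one cross product is minus the other plus twice [c ^+ 2 * x ^+ 2]; the square of [c * x]
   then removes one of these two copies. *)
have -> : (x ^+ 2 * t) *+ 2 * (c * x)
    = (c ^+ 2 * x ^+ 2) *+ 2 - (c * x) * (x ^+ 2 * t *+ 2).
  rewrite mulrnAl !mulrnAr -mulrnBl; congr (_ *+ 2).
  rewrite -mulrA (mulrA t) -(cC t) -mulrA tx mulrA -(cC (x ^+ 2)) -mulrA !mulrBr.
  by rewrite -(cC (x ^+ 2)) !expr2 !mulrA.
have -> : c * x * (c * x) = c ^+ 2 * x ^+ 2.
  by rewrite !expr2 !mulrA -(mulrA c x c) -(cC x) !mulrA.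
by rewrite -addrA -opprD addrA subrK mulr2n addrK.
Qed.

Section HeckeRelations.
Variables (R : realType) (W : weyl_type) (n : nat) (u v : R[i]).
Local Notation H := (spin_hecke W n u v).
Local Notation b := (hecke_b W n u v).
Local Notation t := (hecke_t W n u v).

(** Trades scaling for multiplication by [k *: 1], which plays the part of [c] in the ring
    lemmas. *)
Lemma hecke_scaleE (k : R[i]) (a : H) : k *: a = (k *: (1 : H)) * a.
Proof. by rewrite -[in LHS](mul1r a); apply: presented_scalerAl. Qed.

Lemma hecke_scalar_comm (k : R[i]) (a : H) :
  (k *: (1 : H)) * a = a * (k *: (1 : H)).
Proof. by rewrite -hecke_scaleE -[in LHS](mulr1 a); apply: presented_scalerAr. Qed.

Lemma hecke_sqr_scaleE (k : R[i]) (a : H) : k ^+ 2 *: a = (k *: (1 : H)) ^+ 2 * a.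
Proof.
by rewrite expr2 -scalerA hecke_scaleE [k *: a]hecke_scaleE mulrA -expr2.
Qed.

Lemma hecke_scale_sqr (D x : H) (k : R[i]) :
  (D - k *: x) ^+ 2 = (D - (k *: (1 : H)) * x) ^+ 2.
Proof. by rewrite [k *: x]hecke_scaleE. Qed.

Lemma hecke_tt i : (1 <= i <= weyl_rank W n)%N -> t i ^+ 2 = 1.
Proof.
move=> hi; rewrite -[RHS](rmorph1 (proj (@hecke_rel R W n u v))) -rmorphXn.
by apply: proj_rel; constructor.
Qed.

Lemma hecke_banti i j : (1 <= i <= n)%N -> (1 <= j <= n)%N -> i != j ->
  b i * b j = - (b j * b i).
Proof.
move=> hi hj ij; rewrite -!rmorphM -rmorphN.
by apply: proj_rel; constructor.
Qed.

(** Covers [rel_tb], [relD_tb] and [relB_tb] at once, with [j] equal to [i.+1], [i.-1] and [i]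
    respectively. *)
Lemma hecke_cross i j l (k : R[i]) :
    @hecke_rel R W n u v (tF R W n l * bF R W n i + bF R W n j * tF R W n l) k%:A ->
  t l * b i + b j * t l = k *: (1 : H).
Proof.
move=> /proj_rel; rewrite linearZ rmorph1 => <-.
by rewrite rmorphD !rmorphM.
Qed.

End HeckeRelations.

Theorem proposition4p9 (R : realType) (n : nat) (u v : R[i]) :
  [/\ forall W : weyl_type, weyl_admissible W n ->
        forall i : nat, (1 <= i <= n.-1)%N ->
        let b : nat -> spin_hecke W n u v := hecke_b W n u v in
        intertwiner W n u v i ^+ 2
          = u ^+ 2 *: (b i.+1 ^+ 2 + b i ^+ 2)
              - (b i.+1 ^+ 2 - b i ^+ 2) ^+ 2,
      weyl_admissible TypeD n ->
        let b : nat -> spin_hecke TypeD n u v := hecke_b TypeD n u v in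
        intertwiner TypeD n u v n ^+ 2
          = u ^+ 2 *: (b n ^+ 2 + b n.-1 ^+ 2)
              - (b n ^+ 2 - b n.-1 ^+ 2) ^+ 2
    & weyl_admissible TypeB n ->
        let b : nat -> spin_hecke TypeB n u v := hecke_b TypeB n u v in
        intertwiner TypeB n u v n ^+ 2
          = b n ^+ 4 *+ 4 - v ^+ 2 *: b n ^+ 2].

Proof.
split=> [W Wn i /andP[i1 iN] b | n4 b | n2 b]; rewrite /intertwiner.
(* As [n.-1] is truncated, [n = 0] must be excluded before [i < n] follows. *)
- have n0 : (0 < n)%N by case: (n) iN; case: (i) i1.
  have ltin : (i < n)%N by rewrite -(prednK n0) ltnS.
  rewrite ltin hecke_scale_sqr hecke_sqr_scaleE; apply: intertwiner_sqr.
  + exact: hecke_scalar_comm.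
  (* The rank is [n.-1] in type A, but [n] in types B and D, where [i < n] is weakened. *)
  + apply: hecke_tt; rewrite i1 /=; case: (W) => //=; exact: ltnW.
  + by apply: hecke_cross; apply: rel_tb; rewrite i1.
  + by apply: hecke_banti; rewrite ?i1 ?(ltnW ltin) // neq_ltn ltnSn.
- have n1 : (1 < n)%N by apply: leq_trans n4.
  (* At index [n] the test [i < n] fails, which selects the type-specific branch of
     [intertwiner]. *)
  rewrite ltnn hecke_scale_sqr hecke_sqr_scaleE; apply: intertwiner_swap_sqr.
  + exact: hecke_scalar_comm.
  + by apply: hecke_tt; rewrite leqnn andbT ltnW.
  + by apply: hecke_cross; apply: relD_tb.
  + apply: hecke_banti; rewrite ?leqnn ?leq_pred ?andbT ?(ltnW n1) //.
      by rewrite -ltnS prednK // ltnW.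
    by rewrite neq_ltn ltn_predL (ltnW n1) orbT.
- rewrite ltnn hecke_scale_sqr hecke_sqr_scaleE; apply: intertwinerB_sqr.
  + exact: hecke_scalar_comm.
  + by apply: hecke_tt; rewrite leqnn andbT ltnW.
  + by apply: hecke_cross; apply: relB_tb.
Qed.
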